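(* For $n,m\ge 0$ let $s_{n,m}$ be the number of permutations $\pi\in S_n$ with exactly $m$ vertical separators, and let $h(z,u)=\sum_{n\ge 0}\sum_{m=0}^{n}s_{n,m}z^nu^m$. Then $$h(z,u)=\sum_{m_o,m_e\ge 0}(m_o+m_e)!\left[\left(z^2+\frac{2z^4(u-1)}{1-z^2(u-1)}\right)^{m_o}\right]*\left[\left(z^2+\frac{2z^4(u-1)}{1-z^2(u-1)}\right)^{m_e}\right]$$ $$\qquad+\sum_{m_o,m_e\ge 0}(m_o+m_e)!\left[\frac1z\left(z^2+\frac{2z^4(u-1)}{1-z^2(u-1)}\right)^{m_o}\right]*\left[z\left(z^2+\frac{2z^4(u-1)}{1-z^2(u-1)}\right)^{m_e}\right],$$ where $*$ denotes the Hadamard product with respect to the variable $z$.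
   Context: $S_n$ is the symmetric group on $\{1,\dots,n\}$; a permutation is written in one-line notation $\pi=[\pi_1,\dots,\pi_n]$. The digit $\pi_i$ is a vertical separator of $\pi$ if $1<i<n$ and $|\pi_{i-1}-\pi_{i+1}|=1$. Convention: $S_0$ consists of the empty permutation, which has no separators, so $s_{0,0}=1$. Hadamard product: for series $f=\sum_n a_nz^n$ and $g=\sum_n b_nz^n$ in $z$ with coefficients $a_n,b_n\in\mathbb{Q}[[u]]$, $f*g=\sum_n a_nb_nz^n$. The fraction $\frac{1}{1-z^2(u-1)}$ is expanded as the geometric series $\sum_{j\ge0}z^{2j}(u-1)^j$ in $z$. Products are coefficientwise also for Laurent series in $z$: when $m_o=0$, the left factor in the second sum is $z^{-1}$, and its Hadamard product with a power series in $z$ is $0$. The sums over $m_o,m_e$ are sums of formal power series in $z$ (only finitely many terms contribute to each power of $z$). *)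

(* Defs.v *)
From HB Require Import structures.
From mathcomp Require Import all_boot all_order all_algebra all_fingroup.
From mathcomp Require Import all_classical.

Set Implicit Arguments.
Unset Strict Implicit.
Unset Printing Implicit Defensive.
Import Order.TTheory GRing.Theory Num.Theory.

Local Open Scope ring_scope.

Record fps (R : Type) := FPS { fps_coef :> nat -> R }.

Notation "{ 'fps' R }" := (fps R) (at level 0, format "{ 'fps'  R }").

HB.instance Definition _ (R : Type) := gen_eqMixin {fps R}.
HB.instance Definition _ (R : Type) := gen_choiceMixin {fps R}.

Lemma fpsP (R : Type) (f g : {fps R}) : (forall n, f n = g n) -> f = g.
Proof.
case: f g => f [g] /= fg.
by congr FPS; apply/funext.
Qed.

Section FpsRing.
Variable R : comNzRingType.
Implicit Types f g h : {fps R}.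

Definition fps_zero : {fps R} := FPS (fun=> 0).
Definition fps_opp f : {fps R} := FPS (fun n => - f n).
Definition fps_add f g : {fps R} := FPS (fun n => f n + g n).

Fact fps_addA : associative fps_add.
Proof. by move=> f g h; apply: fpsP => n; apply: addrA. Qed.
Fact fps_addC : commutative fps_add.
Proof. by move=> f g; apply: fpsP => n; apply: addrC. Qed.
Fact fps_add0 : left_id fps_zero fps_add.
Proof. by move=> f; apply: fpsP => n; apply: add0r. Qed.
Fact fps_addN : left_inverse fps_zero fps_opp fps_add.
Proof. by move=> f; apply: fpsP => n; apply: addNr. Qed.

HB.instance Definition _ :=
  GRing.isZmodule.Build {fps R} fps_addA fps_addC fps_add0 fps_addN.

Definition fps_const (c : R) : {fps R} :=
  FPS (fun n => if n == 0%N then c else 0).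
Definition fps_mul f g : {fps R} :=
  FPS (fun n => \sum_(i < n.+1) f i * g (n - i)%N).

Definition fps_trunc (N : nat) f : {poly R} := \poly_(i < N.+1) f i.

Fact coef_fps_trunc N f n : (n <= N)%N -> (fps_trunc N f)`_n = f n.
Proof. by rewrite coef_poly ltnS => ->. Qed.

Fact coef_fps_mul_trunc N f g n : (n <= N)%N ->
  fps_mul f g n = (fps_trunc N f * fps_trunc N g)`_n.
Proof.
move=> nN; rewrite coefM; apply: eq_bigr => i _.
rewrite !coef_fps_trunc // (leq_trans _ nN) ?leq_subr //.
by rewrite -ltnS.
Qed.

Fact fps_mulC : commutative fps_mul.
Proof.
by move=> f g; apply: fpsP => n; rewrite !(@coef_fps_mul_trunc n) // mulrC.
Qed.

Fact fps_mulA : associative fps_mul.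
Proof.
move=> f g h; apply: fpsP => n.
have le_n (i : 'I_n.+1) : (i <= n)%N by rewrite -ltnS.
transitivity (fps_trunc n f * (fps_trunc n g * fps_trunc n h))`_n.
  rewrite coefM; apply: eq_bigr => i _; rewrite coef_fps_trunc //.
  by rewrite (@coef_fps_mul_trunc n) // leq_subr.
rewrite mulrA coefM; apply: eq_bigr => i _.
by rewrite (@coef_fps_mul_trunc n) // coef_fps_trunc // leq_subr.
Qed.

Fact fps_mul1 : left_id (fps_const 1) fps_mul.
Proof.
move=> f; apply: fpsP => n; rewrite /= big_ord_recl /= subn0 mul1r.
by rewrite big1 ?addr0 // => i _; rewrite mul0r.
Qed.

Fact fps_mulDl : left_distributive fps_mul fps_add.
Proof.
move=> f g h; apply: fpsP => n /=; rewrite -big_split.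
by apply: eq_bigr => i _; rewrite mulrDl.
Qed.

Fact fps_oner_neq0 : fps_const 1 != 0.
Proof. apply/eqP => /(congr1 (fun f : {fps R} => f 0%N))/= /eqP.
by rewrite oner_eq0. Qed.

HB.instance Definition _ := GRing.Zmodule_isComNzRing.Build {fps R}
  fps_mulA fps_mulC fps_mul1 fps_mulDl fps_oner_neq0.

Definition fps_X : {fps R} := FPS (fun n => if n == 1%N then 1 else 0).

(** The expansion of [1 / (1 - f)] as [\sum_(j >= 0) f ^+ j], for a series [f]
    without constant term.  Then [f ^+ j] has order at least [j], so the powers
    with [j > n] do not contribute to the coefficient of index [n]. *)
Definition fps_geom f : {fps R} := FPS (fun n => \sum_(j < n.+1) (f ^+ j) n).

Lemma fps_order_exp f j n : f 0%N = 0 -> (n < j)%N -> (f ^+ j) n = 0.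
Proof.
move=> f0; elim: j n => // j IHj n ltnj; rewrite exprS.
apply: big1 => -[[|i] /= lti] _; first by rewrite f0 mul0r.
rewrite IHj ?mulr0 //; apply: (@leq_trans n) => //.
by rewrite ltn_subrL; case: n lti {ltnj}.
Qed.

Lemma fps_geomK f : f 0%N = 0 -> (1 - f) * fps_geom f = 1.
Proof.
move=> f0.
have coef_sum N n : (\sum_(j < N) f ^+ j) n = \sum_(j < N) (f ^+ j) n.
  by elim: N => [|N IH]; rewrite ?big_ord0 // !big_ord_recr /= IH.
apply: fpsP => n.
transitivity (((1 - f) * \sum_(j < n.+1) f ^+ j) n).
  apply: eq_bigr => i _; congr (_ * _); rewrite coef_sum /=.
  rewrite (big_ord_widen _ (fun j => (f ^+ j) (n - i)%N)
             (_ : (n - i).+1 <= n.+1)%N) ?ltnS ?leq_subr //.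
  rewrite big_mkcond /=; apply: eq_bigr => j _; case: ifPn => //.
  by rewrite -ltnNge => ltj; rewrite fps_order_exp.
rewrite -opprB mulNr -subrX1 opprB; set e : {fps R} := 1.
change (e n - (f ^+ n.+1) n = e n).
by rewrite fps_order_exp ?subr0.
Qed.

End FpsRing.

(** Laurent series are represented by their coefficients in all degrees; no
    lower bound on the support is needed for the operations below. *)

Definition laurent (R : Type) := int -> R.

Definition laurent_of_fps (R : comNzRingType) (f : {fps R}) : laurent R :=
  fun k => if k is Posz n then f n else 0.

(* multiplication by the [e]-th power of the variable *)
Definition laurent_shift (R : Type) (e : int) (F : laurent R) : laurent R :=
  fun k => F (k - e).

Definition laurent_add (R : comNzRingType) (F G : laurent R) : laurent R :=
  fun k => F k + G k.

Definition laurent_natmul (R : comNzRingType) (c : nat) (F : laurent R) :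
  laurent R := fun k => c%:R * F k.

Definition hadamard (R : comNzRingType) (F G : laurent R) : laurent R :=
  fun k => F k * G k.

Section DoubleSums.
Variable R : comNzRingType.
Implicit Type F : nat -> nat -> laurent R.

Definition laurent_summable F : Prop :=
  forall k, finite_set [set p : nat * nat | F p.1 p.2 k != 0]%classic.

(* meaningful only when [laurent_summable F] *)
Definition laurent_sum F : laurent R :=
  fun k => \sum_(p \in [set: nat * nat]%classic) F p.1 p.2 k.

End DoubleSums.

(* Digits and positions of [p : 'S_n] are numbered from [0]; the existence of
   both neighbours [j] and [k] excludes the two end positions. *)

Definition vertical_separator (n : nat) (p : 'S_n) (i : 'I_n) : bool :=
  [exists j : 'I_n, exists k : 'I_n,
    [&& i == j.+1 :> nat, k == i.+1 :> nat &
        `|(p j)%:Z - (p k)%:Z| == 1]].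

Definition num_separators (n : nat) (p : 'S_n) : nat :=
  #|[set i | vertical_separator p i]|.

Definition s_ (n m : nat) : nat := #|[set p : 'S_n | num_separators p == m]|.

Definition u : {fps rat} := fps_X rat.
Definition z : {fps {fps rat}} := fps_X {fps rat}.

Definition h : {fps {fps rat}} :=
  FPS (fun n => \sum_(0 <= m < n.+1) (s_ n m)%:R * u ^+ m).

Definition w : {fps {fps rat}} :=
  z ^+ 2
  + 2 * z ^+ 4 * fps_const (u - 1) * fps_geom (z ^+ 2 * fps_const (u - 1)).

(* Main.v *)
Require Import Defs.
From mathcomp Require Import all_boot all_order all_algebra all_fingroup.
From mathcomp Require Import all_classical.
From mathcomp Require Import zify ring.

(** Put [x = u - 1], so that [u ^ k] is the sum of [x ^ #|T|] over the subsets
    [T] of a set of [k] separators.  A separator at [i] links the positions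
    [i - 1] and [i + 1]; listing first the odd and then the even positions turns
    the links into pairs of consecutive entries of two chains.  A set [T] of
    links cuts the chains into [mo] and [me] blocks, and a permutation respects
    [T] when each block takes consecutive values, increasing or decreasing:
    there are [(mo + me)! 2 ^ r] such permutations, with [r] the number of
    blocks of length at least 2.  This count follows by induction on the length:
    a new first entry with value [j] breaks the link with values [j - 1] and [j],
    so it has [n + 1 - #|T|] free values if it is not linked, and 2 or 1 values
    if it is linked to a singleton or to a longer block.  The cuttings of a chain
    of length [N] into [m] blocks, weighted by [x ^ #|T| 2 ^ r], add up to the
    coefficient of [z ^ (2 N)] in [w ^ m]: both satisfy the recurrence given by
    [w = z ^ 2 (1 + x z ^ 2) / (1 - x z ^ 2)]. *)

Set Implicit Arguments.
Unset Strict Implicit.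
Unset Printing Implicit Defensive.

(** * Links between consecutive entries, and insertion of a new first entry *)

Definition adjacent (a b : nat) : bool := (a == b.+1) || (b == a.+1).

(** [bump j] frees the value [j] by raising all values from [j] on, so it separates two neighbouring
    values only if the larger one is [j]. *)
Lemma adjacent_bump j a b :
  adjacent (bump j a) (bump j b) = adjacent a b && (j != maxn a b).
Proof. rewrite /adjacent /bump; lia. Qed.

Lemma adjacent_bump_self j b :
  adjacent j (bump j b) = (j == b) || (j == b.+1).
Proof. rewrite /adjacent /bump; lia. Qed.

Definition adjacent_head (a : nat) (s : seq nat) : bool :=
  if s is b :: _ then adjacent a b else false.

(* A bit sequence [T] selects links: the [i]-th bit asks that the entries of
   index [i] and [i + 1] be adjacent. *)
Fixpoint linked (T : bitseq) (s : seq nat) : bool :=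
  match T, s with
  | t :: T', a :: s' => (t ==> adjacent_head a s') && linked T' s'
  | _, _ => true
  end.

(* The larger entries of the links selected by [T]. *)
Fixpoint tops (T : bitseq) (s : seq nat) : seq nat :=
  match T, s with
  | t :: T', a :: s' => nseq t (maxn a (head 0 s')) ++ tops T' s'
  | _, _ => [::]
  end.

(** Counts the blocks of length at least 2, each at its last link. *)
Fixpoint runs (T : bitseq) : nat :=
  if T is t :: T' then t && ~~ head false T' + runs T' else 0.

Lemma adjacent_head_bump j a s :
  adjacent_head (bump j a) (map (bump j) s) =
  adjacent_head a s && (j != maxn a (head 0 s)).
Proof. by case: s => //= b s; rewrite adjacent_bump. Qed.

(* Inserting the value [j] breaks exactly the link whose larger entry is [j]. *)
Lemma linked_bump j T s :
  linked T (map (bump j) s) = linked T s && (j \notin tops T s).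
Proof.
elim: T s => [|t T IH] [|a s] //=.
rewrite IH adjacent_head_bump; case: t => //=.
by rewrite in_cons negb_or -!andbA; do !bool_congr.
Qed.

Lemma mem_tops T s m : linked T s -> m \in tops T s ->
  [/\ 0 < m, m \in s & m.-1 \in s].
Proof.
elim: T s => [|t T IH] [|a s] //= /andP[lt lT].
rewrite mem_cat => /orP[|/IH[]// ? ms m1s]; last first.
  by split; rewrite // in_cons ?ms ?m1s orbT.
case: t lt => //=; case: s lT => [|b s] //= _.
rewrite mem_seq1 /adjacent => ab /eqP->; rewrite !in_cons.
by case/orP: ab => /eqP ->; split; rewrite ?inE; lia.
Qed.

(** A top [m] needs both [m] and [m.-1] among the entries; if a later link had the same top as the
    first one, the first entry would occur twice. *)
Lemma uniq_tops T s : uniq s -> linked T s -> uniq (tops T s).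
Proof.
elim: T s => [|t T IH] [|a s] //= /andP[a_s us] /andP[lt lT].
rewrite cat_uniq IH // andbT has_sym; case: t lt => //=.
case: s a_s us lT => [|b s] //= a_s us lT ab; rewrite orbF.
apply: contra a_s => /(mem_tops lT)[_].
have [/eqP -> | /eqP ->] := orP ab.
  by rewrite (maxn_idPl (leqnSn b)).
by rewrite (maxn_idPr (leqnSn a)).
Qed.

Lemma size_tops T s :
  size T <= size s -> size (tops T s) = count id T.
Proof.
elim: T s => [|t T IH] [|a s] //= sT.
by rewrite size_cat size_nseq IH.
Qed.

Lemma count_mem_iota (r : seq nat) n :
  uniq r -> all (ltn^~ n) r -> count [in r] (iota 0 n) = size r.
Proof.
move=> ur /allP rn; rewrite -size_filter; apply: perm_size.
apply: uniq_perm; rewrite ?filter_uniq ?iota_uniq // => m.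
by rewrite mem_filter mem_iota /=; case: (boolP (m \in r)) => // /rn.
Qed.

Lemma linked_insertion b T s j :
  linked (true :: T) (j :: map (bump j) (b :: s)) =
  linked T (b :: s) &&
    (((j == b) || (j == b.+1)) && (j \notin tops T (b :: s))).
Proof.
rewrite [LHS]/= -/(map (bump j) (b :: s)) linked_bump adjacent_bump_self.
by rewrite andbCA.
Qed.

(* Of the two values [b] and [b + 1] that link a new entry to [b], exactly one
   breaks the link that starts at [b], if there is one. *)
Lemma link_values b T s : uniq (b :: s) -> linked T (b :: s) ->
  exists r : seq nat,
    [/\ uniq r, all (leq^~ b.+1) r, size r = 2 ^ ~~ head false T &
     forall j, ((j == b) || (j == b.+1)) && (j \notin tops T (b :: s)) =
               (j \in r)].
Proof.
move=> /= /andP[b_s us].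
have tops_b T' m : linked T' s -> m \in tops T' s -> (m != b) && (m != b.+1).
  move=> lT' /(mem_tops lT')[m0 ms m1s].
  apply/andP; split; apply: contraNneq b_s => mb; first by rewrite -mb.
  by rewrite mb in m1s.
case: T => [|[] T] /=.
- move=> _; exists [:: b; b.+1]; split=> //=; rewrite ?inE; try lia.
  by move=> j; rewrite !inE andbT.
- case: s {b_s us} tops_b => [|c s] tops_b /andP[//= bc lT].
  have [/eqP bE | /eqP cE] := orP bc.
    exists [:: b.+1]; split=> //=; first lia.
    move=> j; rewrite !inE; move: (tops_b T j lT).
    by case: (j \in tops T (c :: s)) => [/(_ isT)|_]; lia.
  exists [:: b]; split=> //=; first lia.
  move=> j; rewrite !inE; move: (tops_b T j lT).
  by case: (j \in tops T (c :: s)) => [/(_ isT)|_]; lia.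
move=> lT; exists [:: b; b.+1]; split=> //=; rewrite ?inE; try lia.
move=> j; rewrite !inE; move: (tops_b T j lT).
by case: (j \in tops T s) => [/(_ isT)|_]; lia.
Qed.

Lemma count_insertion (t : bool) T s n :
    uniq s -> all (ltn^~ n) s -> size s = n -> size T <= n ->
    last t T = false ->
  count (fun j => linked (t :: T) (j :: map (bump j) s)) (iota 0 n.+1) =
  linked T s * (if t then 2 ^ ~~ head false T else n.+1 - count id T).
Proof.
move=> us s_lt sz_s sT Tlast.
case: t Tlast => Tlast; last first.
  rewrite (eq_count (fun j => linked_bump j T s : linked (false :: T) (j :: _) = _)).
  case: (boolP (linked T s)) => lT; last by rewrite count_pred0.
  rewrite mul1n -[n.+1 in RHS](size_iota 0).
  rewrite -(count_predC [in tops T s] (iota 0 _)).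
  rewrite count_mem_iota ?uniq_tops //; last first.
    by apply/allP => m /(mem_tops lT)[_ /(allP s_lt) /ltnW].
  by rewrite size_tops ?sz_s // addKn.
(* If [s] is empty, so is [T], and the last bit would be the true bit [t]. *)
case: s us s_lt sz_s => [|b s] us s_lt sz_s.
  by case: T Tlast sT; rewrite -?sz_s.
rewrite (eq_count (linked_insertion b T s)).
case: (boolP (linked T (b :: s))) => lT; last by rewrite count_pred0.
have [r [ur r_le <- Er]] := link_values us lT.
rewrite mul1n (eq_count Er) count_mem_iota //.
apply/allP => m /(allP r_le) mb; apply: (leq_trans (mb : m < b.+2)).
by apply: (allP s_lt); rewrite mem_head.
Qed.

(** * One-line notation and the number of permutations respecting given links *)

Definition oneline n (p : 'S_n) : seq nat := [seq p i : nat | i <- enum 'I_n].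

Lemma size_oneline n (p : 'S_n) : size (oneline p) = n.
Proof. by rewrite size_map size_enum_ord. Qed.

Lemma uniq_oneline n (p : 'S_n) : uniq (oneline p).
Proof.
rewrite map_inj_uniq ?enum_uniq // => i j /val_inj; exact: perm_inj.
Qed.

Lemma oneline_lt n (p : 'S_n) : all (ltn^~ n) (oneline p).
Proof. by apply/allP => _ /mapP[i _ ->] /=. Qed.

Lemma nth_oneline n (p : 'S_n) (i : 'I_n) : nth 0 (oneline p) i = p i.
Proof.
by rewrite (nth_map i) ?size_enum_ord // nth_ord_enum.
Qed.

Lemma oneline_lift n (j : 'I_n.+1) (s : 'S_n) :
  oneline (lift_perm ord0 j s) = (j : nat) :: map (bump j) (oneline s).
Proof.
rewrite /oneline enum_ordSl /= lift_perm_id -!map_comp; congr cons.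
by apply: eq_map => i /=; rewrite lift_perm_lift.
Qed.

Lemma lift_perm_bij n :
  bijective (fun c : 'I_n.+1 * 'S_n => lift_perm ord0 c.1 c.2 : 'S_n.+1).
Proof.
apply: inj_card_bij; last by rewrite card_prod !card_Sn card_ord factS.
move=> [j s] [j' s'] /= eq_l.
have jj' : j = j' by rewrite -(lift_perm_id ord0 j s) eq_l lift_perm_id.
subst j'; congr pair; apply/permP => k; apply: (@lift_inj _ j).
by rewrite -!(lift_perm_lift ord0) eq_l.
Qed.

Lemma sum_perm_oneline n (F : seq nat -> nat) :
  \sum_(p : 'S_n.+1) F (oneline p) =
  \sum_(s : 'S_n) \sum_(j < n.+1) F ((j : nat) :: map (bump j) (oneline s)).
Proof.
rewrite exchange_big pair_big /= (reindex _ (onW_bij _ (lift_perm_bij n))) /=.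
by apply: eq_bigr => -[j s] _ /=; rewrite oneline_lift.
Qed.

(** Each link merges two blocks, so [n - count id T] is the number of blocks; missing bits count as
    unlinked. *)
Lemma card_linked n T : size T <= n -> last false T = false ->
  \sum_(p : 'S_n) linked T (oneline p) = (n - count id T)`! * 2 ^ runs T.
Proof.
elim: T n => [|t T IH] n.
  by move=> _ _; rewrite muln1 subn0 -card_Sn sum1_card; apply: eq_card.
case: n => // n; rewrite [size _]/= ltnS => sT Tlast.
rewrite (sum_perm_oneline _ (fun s => linked (t :: T) s)).
transitivity (\sum_(s : 'S_n) linked T (oneline s) *
    (if t then 2 ^ ~~ head false T else n.+1 - count id T)).
  apply: eq_bigr => s _.
  rewrite -count_insertion ?uniq_oneline ?size_oneline ?oneline_lt //.
  rewrite -(big_mkord xpredT (fun j => linked (t :: T) (j :: map (bump j) (oneline s)) : nat)).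
  by rewrite -big_mkcond sum1_count /index_iota subn0.
rewrite -big_distrl /= IH //; last by case: T {IH sT} Tlast.
have cT : count id T <= n := leq_trans (count_size _ _) sT.
case: t Tlast => Tlast /=; first by rewrite add1n subSS expnD; lia.
by rewrite !add0n subSn // factS; lia.
Qed.

(** * Separators as links of two chains *)

(* Indices start at [0]: [evens] lists the odd positions of the paper. *)
Fixpoint evens (T : Type) (s : seq T) : seq T :=
  if s is a :: _ :: s' then a :: evens s' else s.

Definition odds (T : Type) (s : seq T) : seq T := evens (behead s).

Lemma evens_cons (T : Type) (a : T) s : evens (a :: s) = a :: odds s.
Proof. by case: s. Qed.

Lemma odds_cons (T : Type) (a : T) s : odds (a :: s) = evens s.
Proof. by []. Qed.

Lemma size_evens_odds (T : Type) (s : seq T) :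
  size (evens s) = uphalf (size s) /\ size (odds s) = (size s)./2.
Proof.
by elim: s => // a s [IHe IHo]; rewrite evens_cons odds_cons /= IHe IHo.
Qed.

Lemma perm_evens_odds (T : eqType) (s : seq T) :
  perm_eq (evens s ++ odds s) s.
Proof.
elim: s => // a s IH; rewrite evens_cons odds_cons /= perm_cons.
by rewrite perm_catC.
Qed.

Lemma map_evens_odds (T U : Type) (f : T -> U) (s : seq T) :
  evens (map f s) = map f (evens s) /\ odds (map f s) = map f (odds s).
Proof.
elim: s => // a s [IHe IHo]; split; last by rewrite !odds_cons IHe.
by rewrite [map f _]/= !evens_cons IHo.
Qed.

Fixpoint links (s : seq nat) : nat :=
  if s is a :: s' then adjacent_head a s' + links s' else 0.

Fixpoint separators (s : seq nat) : nat :=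
  if s is a :: s' then adjacent_head a (behead s') + separators s' else 0.

(** Prepending an entry swaps the two chains and puts the entry in front of one of them, where its
    successor is the entry two places further in [s]. *)
Lemma separators_links s : separators s = links (evens s) + links (odds s).
Proof.
elim: s => // a s IH; rewrite evens_cons odds_cons /= IH.
rewrite addnA addnAC; congr (_ + _ + _).
by case: s {IH} => [|b [|c s]] //=; rewrite odds_cons evens_cons.
Qed.

Lemma separators_nth s : separators s =
  \sum_(i < size s) ((i.+2 < size s) && adjacent (nth 0 s i) (nth 0 s i.+2)).
Proof.
elim: s => [|a s IH] /=; first by rewrite big_ord0.
rewrite big_ord_recl IH; congr (_ + _).
by case: s {IH} => [|b [|c s]].
Qed.

Lemma num_separatorsE n (p : 'S_n) : num_separators p = separators (oneline p).
Proof.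
rewrite /num_separators -sum1_card separators_nth size_oneline.
under eq_bigl do rewrite inE; rewrite big_mkcond /=.
case: n p => [|n] p; first by rewrite !big_ord0.
(* One side indexes a separator by its own position, the other by its left neighbour: the first term
   of one and the last term of the other vanish, and the rest match. *)
rewrite big_ord_recl big_ord_recr /= addnC; congr (_ + _); last first.
  have -> : (n.+2 < n.+1) = false by lia.
  case: ifP => // /existsP[j /existsP[k]].
  by case/and3P=> /eqP.
apply: eq_bigr => i _.
have -> (b : bool) : (if b then 1 else 0) = b by case: b.
congr nat_of_bool; apply/existsP/andP => [[j /existsP[k]]|[i2 adj]].
  case/and3P=> /eqP[ij] /eqP ki /eqP pjk.
  have ltk := ltn_ord k; rewrite ki in ltk.
  split; first exact: ltk.
  have -> : i = j :> nat by [].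
  have -> : j.+2 = k by rewrite ki -ij.
  by rewrite !nth_oneline /adjacent; lia.
have i0 : i < n.+1 by lia.
exists (Ordinal i0); apply/existsP; exists (Ordinal i2).
rewrite /= /bump /= add1n !eqxx /=.
move: adj; rewrite -[X in nth 0 _ X]/(val (Ordinal i0)).
rewrite -[X in adjacent _ (nth 0 _ X)]/(val (Ordinal i2)).
by rewrite !nth_oneline /adjacent; lia.
Qed.

(** Listing one chain after the other is a fixed rearrangement [r] of the positions, and
    multiplication by [r] permutes ['S_n]. *)
Lemma sum_perm_evens_odds n (F : seq nat -> nat) :
  \sum_(p : 'S_n) F (evens (oneline p) ++ odds (oneline p)) =
  \sum_(p : 'S_n) F (oneline p).
Proof.
have /tuple_permP[r Er] : perm_eq (evens (enum 'I_n) ++ odds (enum 'I_n))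
    (ord_tuple n) by rewrite val_ord_tuple perm_evens_odds.
rewrite [RHS](reindex_inj (mulgI r)) /=; apply: eq_bigr => p _; congr F.
rewrite /oneline; have [-> ->] := map_evens_odds (fun i => p i : nat) (enum 'I_n).
rewrite -map_cat Er /= -map_comp; apply: eq_map => i /=.
by rewrite permM tnth_ord_tuple.
Qed.

(** * Cuttings of a chain into blocks *)

(* All ways to cut a chain of [N] entries into blocks: the [i]-th bit tells
   whether the entries [i] and [i + 1] are in the same block, so that the last
   bit is [false]. *)
Fixpoint chains (N : nat) : seq bitseq :=
  if N is N'.+1 then
    map (cons false) (chains N') ++
    (if N' is 0 then [::] else map (cons true) (chains N'))
  else [:: [::]].
Arguments chains : simpl never.

Lemma chainsS N : chains N.+1 =
  map (cons false) (chains N) ++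
  (if N is 0 then [::] else map (cons true) (chains N)).
Proof. by []. Qed.

Lemma chainsP N T : T \in chains N -> size T = N /\ last false T = false.
Proof.
elim: N T => [|N IH] T; first by rewrite inE => /eqP->.
rewrite chainsS mem_cat => /orP[/mapP[T' /IH[sT lT] ->] /=|].
  by rewrite sT.
case: N IH => // N IH /mapP[T' /IH[sT lT] ->] /=.
by case: T' sT lT => //= t T' ->.
Qed.

Lemma count_chain N T : T \in chains N -> count id T <= N.
Proof. by case/chainsP=> <- _; apply: count_size. Qed.

(** As [T1] ends in an unlinked bit, no link crosses the junction. *)
Lemma linked_cat T1 T2 s1 s2 : size T1 = size s1 -> last false T1 = false ->
  linked (T1 ++ T2) (s1 ++ s2) = linked T1 s1 && linked T2 s2.
Proof.
elim: T1 s1 => [|t T1 IH] [|a s1] //= [sz] lastT.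
rewrite IH //; last by case: T1 {IH sz} lastT.
rewrite andbA; congr (_ && _ && _).
by case: T1 {IH} s1 sz lastT => [|t' T1] [|b s1] //= _ ->.
Qed.

Lemma runs_cat T1 T2 : last false T1 = false ->
  runs (T1 ++ T2) = runs T1 + runs T2.
Proof.
elim: T1 => //= t [|t' T1] IH lastT; last by rewrite IH // addnA.
by move: lastT => /= ->.
Qed.

Import GRing.Theory.
Local Open Scope ring_scope.

(** * Weighted sums over cuttings *)

Section Weights.
Variables (R : comNzRingType) (x : R).

Lemma exp_links s : (1 + x) ^+ links s =
  \sum_(T <- chains (size s)) x ^+ count id T * (linked T s)%:R.
Proof.
elim: s => [|a s IH] /=; first by rewrite big_seq1 mulr1.
rewrite chainsS exprD IH big_cat /= big_map /=.
have -> : (if size s is 0 then [::] else map (cons true) (chains (size s))) =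
    (if s is [::] then [::] else map (cons true) (chains (size s))).
  by case: (s).
case: s IH => [|b s] IH; first by rewrite big_nil addr0 mul1r.
rewrite big_map /=; case: (adjacent a b) => /=.
  rewrite expr1 mulrDl mul1r; congr (_ + _); rewrite big_distrr.
  by apply: eq_bigr => T _ /=; rewrite add1n exprS mulrA.
rewrite mul1r [X in _ + X]big1 ?addr0 // => T _.
by rewrite mulr0.
Qed.

Definition chain_weight (m N : nat) : R :=
  \sum_(T <- chains N | (N - count id T == m)%N)
     x ^+ count id T * 2 ^+ runs T.

Lemma sum_separators n :
  \sum_(p : 'S_n) (1 + x) ^+ num_separators p =
  \sum_(mo < n.+1) \sum_(me < n.+1) (mo + me)`!%:R *
     (chain_weight mo (uphalf n) * chain_weight me n./2).
Proof.
have half_n : (uphalf n + n./2)%N = n by rewrite uphalf_half -addnA addnn odd_double_half.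
transitivity (\sum_(T1 <- chains (uphalf n)) \sum_(T2 <- chains n./2)
   x ^+ (count id T1 + count id T2) *
   (\sum_(p : 'S_n) linked (T1 ++ T2) (oneline p))%:R).
  transitivity (\sum_(p : 'S_n) \sum_(T1 <- chains (uphalf n))
     \sum_(T2 <- chains n./2) x ^+ (count id T1 + count id T2) *
     (linked (T1 ++ T2) (evens (oneline p) ++ odds (oneline p)))%:R).
    apply: eq_bigr => p _; rewrite num_separatorsE separators_links exprD.
    have [] := size_evens_odds (oneline p); rewrite size_oneline => sze szo.
    rewrite !exp_links sze szo big_distrl /= [LHS]big_seq [RHS]big_seq.
    apply: eq_bigr => T1 /chainsP[sT1 lT1]; rewrite big_distrr.
    apply: eq_bigr => T2 _ /=; rewrite linked_cat ?sze ?sT1 //.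
    by rewrite exprD mulrACA -natrM mulnb.
  rewrite exchange_big; apply: eq_bigr => T1 _.
  rewrite exchange_big; apply: eq_bigr => T2 _.
  rewrite -(sum_perm_evens_odds _ (fun s => linked (T1 ++ T2) s)).
  by rewrite natr_sum big_distrr.
(* Cuttings are sorted by their number of blocks, at most [k], hence within the common range
   [n.+1]. *)
have widen k (P : bitseq -> R) : (k <= n)%N ->
   \sum_(T <- chains k) P T =
   \sum_(m < n.+1) \sum_(T <- chains k | (k - count id T == m)%N) P T.
  move=> le_kn; rewrite (exchange_big_dep xpredT) //= ; apply: eq_bigr => T _.
  have lt_n : (k - count id T < n.+1)%N by rewrite ltnS (leq_trans (leq_subr _ _)).
  rewrite (big_pred1 (Ordinal lt_n)) //.
rewrite (widen (uphalf n)); last by rewrite -{2}half_n leq_addr.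
apply: eq_bigr => mo _.
have le_half : (n./2 <= n)%N by rewrite -{2}half_n leq_addl.
under eq_bigr => T1 _ do rewrite (widen _ _ le_half).
rewrite exchange_big; apply: eq_bigr => me _ /=.
rewrite /chain_weight big_distrl big_distrr /= [LHS]big_seq_cond [RHS]big_seq_cond.
apply: eq_bigr => T1 /andP[T1c /eqP <-]; rewrite !big_distrr /=.
rewrite [LHS]big_seq_cond [RHS]big_seq_cond.
apply: eq_bigr => T2 /andP[T2c /eqP <-].
have [sT1 lT1] := chainsP T1c; have [sT2 lT2] := chainsP T2c.
rewrite card_linked; last 2 first.
- by rewrite size_cat sT1 sT2 half_n.
- by rewrite last_cat lT1.
rewrite runs_cat // count_cat -{1}half_n.
have -> : (uphalf n + n./2 - (count id T1 + count id T2) =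
  uphalf n - count id T1 + (n./2 - count id T2))%N.
  by have := count_chain T1c; have := count_chain T2c; lia.
by rewrite natrM natrX !exprD; ring.
Qed.

Lemma chain_weight0 N : chain_weight 0 N = (N == 0)%:R.
Proof.
rewrite /chain_weight; case: N => [|N].
  by rewrite unlock /= addr0 mulr1.
rewrite big_seq_cond big1 // => T /andP[/chainsP[sT lT]].
(* The last bit is unlinked, so a nonempty chain has at least one block. *)
have : has (predC id) T.
  case: T sT lT => // t T _ lT; apply/hasP; exists (last t T).
    exact: mem_last.
  by move: lT => /= ->.
by move: sT; rewrite has_count -(count_predC id T); lia.
Qed.

Lemma chain_weightS0 m : chain_weight m.+1 0 = 0.
Proof. by rewrite /chain_weight unlock. Qed.

Lemma chain_weight_false m N :
  \sum_(T <- chains N | ((N.+1 - count id (false :: T))%N == m.+1))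
     x ^+ count id (false :: T) * 2 ^+ runs (false :: T) = chain_weight m N.
Proof.
rewrite /chain_weight big_seq_cond [RHS]big_seq_cond; apply: eq_bigl => T.
case: (boolP (T \in chains N)) => //= /count_chain cT.
by rewrite subSn.
Qed.

(* Linking a new entry to a singleton block gives it two directions, hence a
   factor 2, and linking it to a longer block gives 1: the last two terms come
   from 2 = 1 + 1 and 1 = 0 + 1. *)
Lemma chain_weightSS m N : chain_weight m.+1 N.+2 =
  chain_weight m N.+1 + x * chain_weight m N + x * chain_weight m.+1 N.+1.
Proof.
rewrite {1}/chain_weight chainsS big_cat !big_map.
rewrite -addrA [LHS]/(_ + _); congr (_ + _); first exact: chain_weight_false.
rewrite -[X in x * X + _]chain_weight_false /chain_weight -mulrDr.
transitivity (x * \sum_(T <- chains N.+1 | (N.+1 - count id T == m.+1)%N)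
   (x ^+ count id T * 2 ^+ runs T * (~~ head false T)%:R +
    x ^+ count id T * 2 ^+ runs T)).
  rewrite big_distrr; apply: eq_big => [T|T _] /=; first by rewrite add1n subSS.
  rewrite add1n exprS exprD; case: (head false T) => /=; ring.
rewrite big_split; congr (x * (_ + _)) => /=.
rewrite chainsS big_cat big_map /= [X in _ + X]big1_seq ?addr0.
  by apply: eq_bigr => T _; rewrite mulr1.
move=> T /andP[_]; case: (N) => // N' /mapP[T' _ ->] /=.
by rewrite mulr0.
Qed.

Lemma chain_weight1 m : chain_weight m.+1 1 = chain_weight m 0.
Proof.
by rewrite -(chain_weight_false m 0) {1}/chain_weight chainsS cats0 big_map.
Qed.

End Weights.

Lemma chain_weight_gt (R : comNzRingType) (x : R) m N : (N < m)%N ->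
  chain_weight x m N = 0.
Proof.
move=> ltNm; rewrite /chain_weight big1 // => T /eqP eq_m.
by move: ltNm; rewrite -eq_m ltnNge leq_subr.
Qed.

(** * Coefficients of the powers of [w] and of [h] *)

Lemma coef_fps_constM (R : comNzRingType) (c : R) (f : {fps R}) n :
  (fps_const c * f) n = c * f n.
Proof.
rewrite [LHS]big_ord_recl /= subn0 big1 ?addr0 // => i _.
by rewrite mul0r.
Qed.

Lemma coef_fps_XM (R : comNzRingType) (f : {fps R}) n :
  (fps_X R * f) n = if n is n'.+1 then f n' else 0.
Proof.
rewrite [LHS]big_ord_recl /= mul0r add0r.
case: n => [|n]; first by rewrite big_ord0.
rewrite big_ord_recl /= mul1r subSS subn0 big1 ?addr0 // => i _.
by rewrite mul0r.
Qed.

Lemma coef_fps_X2M (R : comNzRingType) (f : {fps R}) n :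
  (fps_X R ^+ 2 * f) n = if n is n'.+2 then f n' else 0.
Proof.
by rewrite expr2 -mulrA coef_fps_XM; case: n => // n; rewrite coef_fps_XM.
Qed.

(* This is [w = z ^ 2 (1 + x z ^ 2) / (1 - x z ^ 2)] times [w ^+ m], cleared of
   the denominator. *)
Lemma w_recurrence m : w ^+ m.+1 = z ^+ 2 * w ^+ m
  + fps_const (u - 1) * (z ^+ 2 * (z ^+ 2 * w ^+ m))
  + fps_const (u - 1) * (z ^+ 2 * w ^+ m.+1).
Proof.
set c := fps_const (u - 1).
have geomK : (1 - z ^+ 2 * c) * fps_geom (z ^+ 2 * c) = 1.
  apply: fps_geomK; rewrite /z.
  exact: (coef_fps_X2M c 0).
have wE : (1 - z ^+ 2 * c) * w = z ^+ 2 * (1 + z ^+ 2 * c).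
  transitivity ((1 - z ^+ 2 * c) * z ^+ 2 +
     2 * z ^+ 4 * c * ((1 - z ^+ 2 * c) * fps_geom (z ^+ 2 * c))).
    by rewrite /w -/c; ring.
  by rewrite geomK; ring.
apply/eqP; rewrite -subr_eq0; apply/eqP.
transitivity (w ^+ m * ((1 - z ^+ 2 * c) * w - z ^+ 2 * (1 + z ^+ 2 * c))).
  by rewrite exprS; ring.
by rewrite wE subrr mulr0.
Qed.

Lemma coef_w_exp m n :
  (w ^+ m) n = if odd n then 0 else chain_weight (u - 1) m n./2.
Proof.
elim: m n => [|m IHm] n.
  rewrite expr0; case: n => [|n]; first by rewrite chain_weight0.
  case: ifP => // n_even; rewrite chain_weight0.
  by case: n n_even.
(* Strong induction on [n], since the last term of [w_recurrence] keeps the exponent [m.+1] and only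
   lowers the degree by 2. *)
have [k] := ubnP n; elim: k n => // k IHk n lt_nk.
rewrite w_recurrence.
transitivity ((z ^+ 2 * w ^+ m) n
  + (fps_const (u - 1) * (z ^+ 2 * (z ^+ 2 * w ^+ m))) n
  + (fps_const (u - 1) * (z ^+ 2 * w ^+ m.+1)) n); first by [].
rewrite !coef_fps_constM !coef_fps_X2M.
case: n lt_nk => [|[|n]] lt_nk.
- by rewrite /= chain_weightS0 !mulr0 !addr0.
- by rewrite !mulr0 !addr0.
rewrite IHm IHk; last by rewrite -ltnS ltnW.
rewrite coef_fps_X2M /= negbK; case: n lt_nk => [|[|n]] lt_nk /=.
- by rewrite chain_weight1 chain_weightS0 !mulr0 !addr0.
- by rewrite !mulr0 !addr0.
rewrite IHm negbK; case: ifP => _; first by rewrite !mulr0 !addr0.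
by rewrite chain_weightSS.
Qed.

Lemma coef_h n : h n = \sum_(p : 'S_n) u ^+ num_separators p.
Proof.
(* There are at most [n] separators, so [inord] loses nothing. *)
rewrite /h /= (partition_big (fun p : 'S_n => inord (num_separators p) : 'I_n.+1)
  xpredT) //= big_mkord; apply: eq_bigr => m _.
rewrite /s_ -sum1_card natr_sum big_distrl /=.
have Em (p : 'S_n) : (inord (num_separators p) == m) = (num_separators p == m).
  rewrite -val_eqE /= inordK // ltnS -[X in (_ <= X)%N](card_ord n).
  exact: max_card.
apply: eq_big => [p|p]; first by rewrite inE Em.
by rewrite inE mul1r => /eqP ->.
Qed.

(** * Double sums of Laurent series and the final identity *)

Lemma laurent_sum_box (R : comNzRingType) (F : nat -> nat -> laurent R) k N :
    (forall i j, (N <= i)%N || (N <= j)%N -> F i j k = 0) ->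
  finite_set [set p : nat * nat | F p.1 p.2 k != 0]%classic /\
  laurent_sum F k = \sum_(i < N) \sum_(j < N) F i j k.
Proof.
move=> F0; pose r := [seq (i, j) | i <- iota 0 N, j <- iota 0 N].
have r_supp (p : nat * nat) : p \notin r -> F p.1 p.2 k = 0.
  case: p => i j /= ij; apply: F0; apply: contraR ij.
  rewrite negb_or -!ltnNge => /andP[iN jN].
  by apply/allpairsP; exists (i, j); rewrite !mem_iota.
split.
  apply: (sub_finite_set _ (finite_seq r)) => p /=; apply: contra_neqT.
  exact: r_supp.
rewrite /laurent_sum (fsbigE r) //; first last.
- by move=> p _; apply: r_supp.
- by apply: allpairs_uniq; rewrite ?iota_uniq // => -[? ?] [].
rewrite big_mkcond /=.
under eq_bigr => p _ do rewrite in_setT.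
rewrite big_allpairs -[X in iota 0 X]subn0 -/(index_iota 0 N) big_mkord.
by apply: eq_bigr => i _; rewrite big_mkord.
Qed.

Theorem theorem3p11 :
  let S1 (mo me : nat) : laurent {fps rat} :=
    laurent_natmul (mo + me)`!
      (hadamard (laurent_of_fps (w ^+ mo)) (laurent_of_fps (w ^+ me))) in
  let S2 (mo me : nat) : laurent {fps rat} :=
    laurent_natmul (mo + me)`!
      (hadamard (laurent_shift (-1) (laurent_of_fps (w ^+ mo)))
                (laurent_shift 1 (laurent_of_fps (w ^+ me)))) in
  [/\ laurent_summable S1, laurent_summable S2 &
      laurent_of_fps h = laurent_add (laurent_sum S1) (laurent_sum S2)].
Proof.
move=> S1 S2.
pose a m n := chain_weight (u - 1) m n.
have S1E mo me n : S1 mo me (Posz n) =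
    if odd n then 0 else (mo + me)`!%:R * (a mo (uphalf n) * a me n./2).
  rewrite /S1 /laurent_natmul /hadamard /= !coef_w_exp uphalf_half.
  by case: (odd n); rewrite ?mulr0.
(* For odd [n] the shifts read the even degrees [n + 1] and [n - 1], whose halves are [uphalf n] and
   [n./2]; thus [S1] carries the even degrees and [S2] the odd ones. *)
have S2E mo me n : S2 mo me (Posz n) =
    if odd n then (mo + me)`!%:R * (a mo (uphalf n) * a me n./2) else 0.
  rewrite /S2 /laurent_natmul /hadamard /laurent_shift opprK.
  case: n => [|n]; first by rewrite /= !mulr0.
  have -> : n.+1%:Z + 1 = n.+2 by lia.
  have -> : n.+1%:Z - 1 = n by lia.
  rewrite /= !coef_w_exp /= negbK uphalf_half.
  by case: (odd n); rewrite ?mulr0.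
have S1N mo me n : S1 mo me (Negz n) = 0.
  by rewrite /S1 /laurent_natmul /hadamard /= !mulr0.
(* For [mo = 0] the left factor has a term of degree -1, but the right factor vanishes there. *)
have S2N mo me n : S2 mo me (Negz n) = 0.
  rewrite /S2 /laurent_natmul /hadamard /laurent_shift.
  have -> : Negz n - 1 = Negz n.+1 by lia.
  by rewrite /= !mulr0.
(* A chain of at most [n] entries has at most [n] blocks: in each degree a finite box gives both
   summability and the value of the sum. *)
have a0 n mo me : (n.+1 <= mo)%N || (n.+1 <= me)%N ->
    a mo (uphalf n) * a me n./2 = 0.
  move=> /orP[lt_m|lt_m]; rewrite /a.
    by rewrite chain_weight_gt ?mul0r //; lia.
  by rewrite [X in _ * X]chain_weight_gt ?mulr0 //; lia.
pose N (k : int) := if k is Posz n then n.+1 else 0%N.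
have box1 k : forall i j, (N k <= i)%N || (N k <= j)%N -> S1 i j k = 0.
  case: k => n i j /=; last by rewrite S1N.
  by move=> /a0 ij; rewrite S1E ij mulr0 if_same.
have box2 k : forall i j, (N k <= i)%N || (N k <= j)%N -> S2 i j k = 0.
  case: k => n i j /=; last by rewrite S2N.
  by move=> /a0 ij; rewrite S2E ij mulr0 if_same.
split=> [k|k|]; [exact: (laurent_sum_box (box1 k)).1 | exact: (laurent_sum_box (box2 k)).1|].
apply/funext => k; rewrite /laurent_add.
rewrite (laurent_sum_box (box1 k)).2 (laurent_sum_box (box2 k)).2.
case: k => n; last by rewrite !big_ord0 addr0.
transitivity (\sum_(p : 'S_n) u ^+ num_separators p); first exact: coef_h.
have uE : u = 1 + (u - 1) by rewrite addrC subrK.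
rewrite {1}uE sum_separators -big_split; apply: eq_bigr => mo _ /=.
rewrite -big_split; apply: eq_bigr => me _ /=.
by rewrite S1E S2E; case: (odd n); rewrite ?addr0 ?add0r.
Qed.
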